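(* Let $n \in \mathbb{N}$, $n \geq 3$, be arbitrary and let $\mathcal{POPI}_{n}$ be the inverse monoid of orientation-preserving partial permutations of $\{1,\ldots,n\}$ with the usual order. For $k \in \mathbb{N}$, let $\mathbb{P}_{k}$ denote the set of all primes that divide $k$. Then the maximal subsemigroups of $\mathcal{POPI}_{n}$ are precisely: (a) $(\mathcal{POPI}_{n} \setminus \mathcal{C}_{n}) \cup U$, where $U$ is a maximal subgroup of $\mathcal{C}_{n}$ (type (M5)), and (b) $\langle\mathcal{POPI}_{n} \setminus J_{n - 1},\ \zeta_{n}^{p}\rangle$, where $p \in \mathbb{P}_{n - 1}$ and the partial permutation $\zeta_{n}$ is defined by $$\zeta_{n} = \begin{pmatrix} 1 & 2 & \cdots & n - 2 & n - 1 & n\\ 2 & 3 & \cdots & n - 1 & 1 & - \end{pmatrix}$$ (type (M5)). In particular, there are $|\mathbb{P}_{n}| + |\mathbb{P}_{n - 1}|$ maximal subsemigroups of $\mathcal{POPI}_{n}$ for $n \geq 3$. For $n \in \{1, 2\}$, $\mathcal{POPI}_{n} = \mathcal{I}_{n}$, the symmetric inverse monoid of degree $n$.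
   Context: $\mathbb{N}=\{1,2,3,\ldots\}$. A maximal subsemigroup of a semigroup $S$ (maximal subgroup of a group) is a proper subsemigroup (subgroup) not contained in any other proper one. $\langle\cdot\rangle$ denotes the subsemigroup generated by the listed sets and elements. $\mathcal{PT}_n$ is the monoid of all partial maps from $\{1,\ldots,n\}$ to itself under composition (maps written on the right); $\mathcal{I}_n$ is the submonoid of injective elements (partial permutations). If $\operatorname{dom}(\alpha)=\{i_1<\cdots<i_k\}$, put $i_{k+1}=i_1$; $\alpha$ is orientation-preserving if there is at most one $l\in\{1,\ldots,k\}$ with $i_l\alpha>i_{l+1}\alpha$. $J_{n-1}=\{\alpha\in\mathcal{PT}_n:|\operatorname{im}(\alpha)|=n-1\}$. $\mathcal{C}_n$ is the cyclic group generated by the permutation $(1\ 2\ \ldots\ n)$; it is the group of units of $\mathcal{POPI}_n$. In two-line notation, the entry $-$ means that the point above is not in the domain; so $\zeta_n$ has domain and image $\{1,\ldots,n-1\}$. Type (M5): a maximal subsemigroup $M$ of a finite monoid $S$ with $S\setminus M$ contained in the regular $\mathscr{J}$-class $J$ has type (M5) if $M\cap J$ meets every $\mathscr{H}$-class of $J$. *)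

(* Defs.v *)
From HB Require Import structures.
From mathcomp Require Import all_boot all_fingroup gseries.

Set Implicit Arguments.
Unset Strict Implicit.
Unset Printing Implicit Defensive.

Local Open Scope group_scope.

(* Throughout, the point i of {1, ..., n} is the ordinal of value i - 1.
   A partial map sends i to None when i is outside its domain. *)
Definition PT (n : nat) : Type := {ffun 'I_n -> option 'I_n}.
HB.instance Definition _ n := Finite.on (PT n).

(* Maps act on the right: first a, then b. *)
Definition pt_mul n (a b : PT n) : PT n := [ffun i => obind b (a i)].
Definition pt_one n : PT n := [ffun i => Some i].

Fact pt_mulA n : associative (@pt_mul n).
Proof. by move=> a b c; apply/ffunP=> i; rewrite !ffunE; case: (a i) => //= j; rewrite ffunE. Qed.
Fact pt_mul1 n : left_id (@pt_one n) (@pt_mul n).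
Proof. by move=> a; apply/ffunP=> i; rewrite !ffunE. Qed.
Fact pt_mulr1 n : right_id (@pt_one n) (@pt_mul n).
Proof. by move=> a; apply/ffunP=> i; rewrite ffunE; case: (a i) => //= j; rewrite ffunE. Qed.

HB.instance Definition _ n :=
  isMonoid.Build (PT n) (@pt_mulA n) (@pt_mul1 n) (@pt_mulr1 n).

Section Subsemigroups.

(* Every semigroup below is a subset of some PT n. *)
Variable n : nat.
Local Notation T := (PT n).
Implicit Types (S M J A : {set T}) (x y : T).

(* Closure under the product only; whether the empty set counts as a
   subsemigroup affects neither of the next two definitions when S contains 1
   and another element, and A is nonempty. *)
Definition subsemigroup M : bool := [forall x in M, forall y in M, x * y \in M].

Definition gen_subsemigroup A : {set T} :=
  \bigcap_(M : {set T} | subsemigroup M && (A \subset M)) M.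

Definition maximal_subsemigroup S M : bool :=
  maxset (fun N : {set T} => subsemigroup N && (N \proper S)) M.

(* Green's relations of a submonoid S of PT n (so that S^1 = S), through the
   principal right, left and two-sided ideals of S. *)
Definition rideal S x : {set T} := [set x * s | s : T in S].
Definition lideal S x : {set T} := [set s * x | s : T in S].
Definition ideal S x : {set T} := [set s * x * t | s : T in S, t : T in S].

Definition Hclass S x : {set T} :=
  [set y in S | (rideal S y == rideal S x) && (lideal S y == lideal S x)].
Definition Jclass S x : {set T} := [set y in S | ideal S y == ideal S x].

Definition regular_in S x : bool := [exists y in S, x * y * x == x].

Definition type_M5 S M : Prop :=
  maximal_subsemigroup S M /\
  exists2 x, x \in S &
    let J := Jclass S x in
    [/\ {in J, forall y, regular_in S y},
        S :\: M \subset J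
      & {in J, forall y, (M :&: J) :&: Hclass S y != set0}].

End Subsemigroups.

Section PartialMaps.

Variable n : nat.
Implicit Type a : PT n.

Definition pt_im a : {set 'I_n} := [set j | [exists i, a i == Some j]].

Definition pt_injective a : bool :=
  [forall i, forall j, (a i != None) && (a i == a j) ==> (i == j)].

Definition symInv : {set PT n} := [set a | pt_injective a].

(* enum 'I_n is increasing, so s lists the images of i_1 < ... < i_k, and
   rot 1 s those of i_2, ..., i_k, i_1. *)
Definition orientation_preserving a : bool :=
  let s := pmap a (enum 'I_n) in
  count (fun p : 'I_n * 'I_n => p.2 < p.1) (zip s (rot 1%N s)) <= 1.

Definition POPI : {set PT n} := [set a in symInv | orientation_preserving a].

Definition rank_eq (r : nat) : {set PT n} := [set a | #|pt_im a| == r].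

Definition pt_perm (s : 'S_n) : PT n := [ffun i => Some (s i)].

Definition cyc : 'S_n := perm (@ordS_inj n).

Definition Cgroup : {set PT n} := pt_perm @: <[cyc]>.

Definition zeta : PT n :=
  [ffun i : 'I_n => if i.+1 == n then None
                    else if i.+2 == n then insub 0 else insub i.+1].

End PartialMaps.

(* Main.v *)
Require Import Defs.
From HB Require Import structures.
From mathcomp Require Import all_boot all_fingroup gseries.
From mathcomp Require Import cyclic maximal zify.

Set Implicit Arguments.
Unset Strict Implicit.
Unset Printing Implicit Defensive.

Local Open Scope group_scope.

(** The proof rests on a local description of the monoid. A partial injection is
    orientation-preserving exactly when it respects the cyclic order of its
    domain ([POPI_P]), which makes [POPI n] closed under products. The total
    elements are the rotations ([POPI_total]): after a rotation such an element
    fixes the first point, hence is monotone, hence is the identity. In the same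
    way every element of rank [n - 1] can be written uniquely as [c b d], with
    [c] and [d] rotations and [b] a power of [zeta n], that is, the restriction
    to the first [n - 1] points of an element of the cyclic group of order
    [n - 1] generated by [zperm] ([POPI_blockP], [block_inj]). The elements of
    rank at least [n - 1] generate the whole monoid ([POPI_generated]): up to
    rotations an element is monotone, and a monotone partial map is a product of
    slides of one point to an adjacent one and of partial identities of rank
    [n - 1].

    Let [M] be a maximal subsemigroup. If [M] does not contain all units, then
    it can be enlarged by all non-units and stay proper, so it consists of the
    non-units and of a subgroup of the group of units, maximal because [M] is
    ([maximal_not_containing_units]). If [M] contains the units, it can be
    enlarged by the elements of rank below [n - 1], by the generation property;
    so it is determined by the elements of rank [n - 1] in it, that is, by the
    set of middle factors [b] that occur, and this set is a subgroup of
    [<[zperm]>], again maximal ([maximal_containing_units]). Conversely both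
    constructions turn maximal subgroups into maximal subsemigroups. The maximal
    subgroups of a cyclic group generated by [x] are the [<[x ^+ p]>] with [p] a
    prime divisor of the order of [x] ([maximal_cycleP]), which identifies the
    second family with the one in the theorem ([gen_zeta]) and gives the count. *)

(** * Subgroups of finite and of cyclic groups *)

Lemma maximal_cycleP (gT : finGroupType) (x : gT) (U : {group gT}) :
  reflect (exists2 p, p \in primes #[x] & U = <[x ^+ p]>%G) (maximal U <[x]>).
Proof.
have x0 : 0 < #[x] by apply: order_gt0.
apply: (iffP idP) => [maxU | [p]].
  have [/properP[sU [y yx yU]] maxP] := maxgroupP maxU.
  have iU : #|<[x]> : U| != 1%N.
    by rewrite indexg_eq1; apply: contraNN yU => /subsetP-> //.
  have [pp pd] : prime (pdiv #|<[x]> : U|) /\ pdiv #|<[x]> : U| %| #|<[x]> : U|.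
    split; last exact: pdiv_dvd.
    by apply: pdiv_prime; rewrite ltn_neqAle eq_sym iU indexg_gt0.
  set p := pdiv _ in pp pd.
  have Lag : (#|U| * #|<[x]> : U|)%N = #[x] by rewrite Lagrange.
  have px : p %| #[x] by rewrite -Lag dvdn_mull.
  exists p; first by rewrite mem_primes pp x0 px.
  have oxp : #[x ^+ p] = #[x] %/ p := orderXdiv px.
  apply/val_inj/esym/maxP => /=.
    rewrite properEcard cycleX -/(order x) -/(order (x ^+ p)) oxp.
    by rewrite ltn_Pdiv // prime_gt1.
  rewrite -(cardSg_cyclic (cycle_cyclic x)) ?cycleX // -/(order (x ^+ p)) oxp.
  by rewrite -Lag -muln_divA // dvdn_mulr.
rewrite mem_primes => /and3P[pp _ px] ->.
have oxp : #[x ^+ p] = #[x] %/ p := orderXdiv px.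
apply: p_index_maximal; first exact: cycleX.
rewrite -divgS ?cycleX // -/(order x) -/(order (x ^+ p)) oxp.
by rewrite divnA // mulKn.
Qed.

Lemma cycleX_prime_inj (gT : finGroupType) (x : gT) (p q : nat) :
  p \in primes #[x] -> q \in primes #[x] -> <[x ^+ p]> = <[x ^+ q]> -> p = q.
Proof.
rewrite !mem_primes => /and3P[pp x0 px] /and3P[pq _ qx] /(congr1 (fun A : {set gT} => #|A|)).
rewrite -/(order (x ^+ p)) -/(order (x ^+ q)) !orderXdiv // => e.
have q0 : 0 < #[x] %/ q by rewrite divn_gt0 ?prime_gt0 // dvdn_leq.
by apply/eqP; rewrite -(eqn_pmul2l q0) -{1}e !divnK.
Qed.

(** In a finite group, inverses and the identity are powers. *)
Lemma group_set_closed (gT : finGroupType) (V : {set gT}) :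
  V != set0 -> {in V &, forall x y, x * y \in V} -> group_set V.
Proof.
case/set0Pn=> x xV VM; apply/group_setP; split=> //.
have xX k : x ^+ k.+1 \in V.
  by elim: k => [|k IH]; [rewrite expg1 | rewrite expgS VM].
by rewrite -(expg_order x) -(prednK (order_gt0 x)).
Qed.

(** * Cyclic descents and the cyclic order *)

(** The number of descents between consecutive terms of the path [x :: s]. *)
Fixpoint descents n (x : 'I_n) (s : seq 'I_n) : nat :=
  if s is y :: s' then (y < x) + descents y s' else 0.

(** [cyc_le x y z] states that x, y, z, x are met in this order when going once
    around the circle; equalities are allowed. *)
Definition cyc_le n (x y z : 'I_n) : bool := (y < x) + (z < y) + (x < z) <= 1.

Lemma count_descents n (x z : 'I_n) s :
  count (fun p : 'I_n * 'I_n => p.2 < p.1) (zip (x :: s) (rcons s z)) =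
  descents x (rcons s z).
Proof. by elim: s x => [|y s IH] x //=; rewrite -IH. Qed.

Lemma descents_subseq n (x z : 'I_n) s t :
  subseq t s -> descents x (rcons t z) <= descents x (rcons s z).
Proof.
elim: s x t => [|a s IH] x [|b t] //=.
  move=> _; have := IH a [::] (sub0seq s) => /=; lia.
case: eqP => [-> | _] sub; first by rewrite leq_add2l IH.
have := IH a _ sub => /=; lia.
Qed.

(** Cyclic descents do not increase along subsequences, so a sequence with at
    most one cyclic descent has all its triples in cyclic order; conversely,
    measuring triples from the first term shows that the terms above it
    increase and are followed by those below it, which increase too. *)
Lemma count_descentsP n (s : seq 'I_n) :
  (forall x, ~~ subseq [:: x; x] s) ->
  reflect (forall x y z, subseq [:: x; y; z] s -> cyc_le x y z)
    (count (fun p : 'I_n * 'I_n => p.2 < p.1) (zip s (rot 1 s)) <= 1).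
Proof.
case: s => [|x0 s] /= inj; first by constructor.
have x0s : x0 \notin s by have := inj x0; rewrite eqxx sub1seq.
rewrite rot1_cons [count _ _]count_descents.
apply: (iffP idP) => [le1 x y z | tri].
  case: eqP => [-> /= | _] sub; last first.
    have := leq_trans (descents_subseq x0 x0 sub) le1; rewrite /= /cyc_le; lia.
  by have := leq_trans (descents_subseq x0 x0 sub) le1; rewrite /= /cyc_le; lia.
have {}tri y z : subseq [:: y; z] s -> cyc_le x0 y z.
  by move=> sub; apply: tri; rewrite eqxx.
have low (y : 'I_n) t : y < x0 -> subseq (y :: t) s -> descents y (rcons t x0) = 0.
  elim: t y => [|z t IH] y yx sub /=; first lia.
  have zs : z \in s by apply: (mem_subseq sub); rewrite !inE eqxx orbT.
  have zx : z != x0 :> nat by apply: contraNneq x0s => /val_inj <-.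
  have /tri : subseq [:: y; z] s.
    by apply: subseq_trans sub; rewrite /= !eqxx sub0seq.
  rewrite /cyc_le => le1; rewrite IH; try lia.
  by apply: subseq_trans sub; apply: subseq_cons.
have high (y : 'I_n) t : x0 <= y -> subseq (y :: t) s || ((y == x0) && subseq t s) ->
    descents y (rcons t x0) <= 1.
  elim: t y => [|z t IH] y yx sub /=; first by case: (_ < _).
  have subz : subseq (z :: t) s.
    case/orP: sub => [sub|/andP[]//].
    by apply: subseq_trans sub; apply: subseq_cons.
  have zs : z \in s by apply: (mem_subseq subz); rewrite !inE eqxx.
  have zx : z != x0 :> nat by apply: contraNneq x0s => /val_inj <-.
  have [lzx|lxz|ezx] := ltngtP z x0; last 1 first.
  - by rewrite ezx eqxx in zx.
  - by rewrite (low z t) // addn0; case: (_ < _).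
  have le1 : descents z (rcons t x0) <= 1 by apply: IH; rewrite ?subz // ltnW.
  suff : ~~ (z < y) by move/negPf->.
  case/orP: sub => [sub|/andP[/eqP-> _]]; last lia.
  have /tri : subseq [:: y; z] s.
    by apply: subseq_trans sub; rewrite /= !eqxx sub0seq.
  by rewrite /cyc_le; lia.
by apply: high; rewrite // eqxx subseq_refl orbT.
Qed.

Lemma subseq_pmapP (T U : eqType) (f : T -> option U) (s : seq T) (t : seq U) :
  reflect (exists2 u, subseq u s & map f u = map Some t) (subseq t (pmap f s)).
Proof.
apply: (iffP idP) => [|[u + e]].
  elim: s t => [|a s IH] /= t.
    by case: t => [|b t] // _; exists [::].
  case fa: (f a) => [b|] /=; last first.
    by move=> /IH[u us e]; exists u => //; apply: subseq_trans us (subseq_cons _ _).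
  case: t => [_|c t /=]; first by exists [::].
  case: eqP => [-> /IH[u us e] | _ /IH[u us e]].
    by exists (a :: u); rewrite /= ?eqxx // fa e.
  by exists u => //; apply: subseq_trans us (subseq_cons _ _).
elim: s u t e => [|a s IH] [|b u] [|c t] //=; first by rewrite sub0seq.
move=> [fb e].
case: eqP => [<- us | _ us]; first by rewrite fb /= eqxx (IH u).
have /IH/(_ us) : map f (b :: u) = map Some (c :: t) by rewrite /= fb e.
by case: (f a) => [d|] //= H; case: eqP => // _; apply: subseq_trans H; apply: subseq_cons.
Qed.

Lemma subseq_enum_ord n (s : seq 'I_n) :
  subseq s (enum 'I_n) = sorted (fun i j : 'I_n => i < j) s.
Proof.
have tr : transitive (fun i j : 'I_n => i < j) by move=> i j k; apply: ltn_trans.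
have se : sorted (fun i j : 'I_n => i < j) (enum 'I_n).
  by have := iota_ltn_sorted 0 n; rewrite -val_enum_ord sorted_map.
apply/idP/idP => [/(subseq_sorted tr)|ss]; first exact.
apply/(subseq_uniqP (enum_uniq _)).
apply: (irr_sorted_eq tr) => //; first by move=> i; rewrite /= ltnn.
  exact: sorted_filter.
by move=> i; rewrite mem_filter mem_enum andbT.
Qed.

(** Elements of [POPI n] are the partial injections that respect the cyclic
    order of their domain. *)
Lemma POPI_P n (a : PT n) :
  reflect ((forall i j x, a i = Some x -> a j = Some x -> i = j) /\
           (forall i j k x y z, a i = Some x -> a j = Some y -> a k = Some z ->
              cyc_le i j k -> cyc_le x y z))
    (a \in POPI n).
Proof.
rewrite !inE /orientation_preserving /pt_injective.
have injP : reflect (forall i j x, a i = Some x -> a j = Some x -> i = j)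
    [forall i, forall j, (a i != None) && (a i == a j) ==> (i == j)].
  apply: (iffP forallP) => [H i j x ai aj | H i].
    have /forallP/(_ j) := H i; rewrite ai aj eqxx /= => /eqP; exact.
  apply/forallP => j; apply/implyP; case ai: (a i) => [x|] //= /eqP aj.
  by apply/eqP; apply: H ai (esym aj).
case: injP => [inj | ninj] /=; last by constructor; case.
have inj2 x : ~~ subseq [:: x; x] (pmap a (enum 'I_n)).
  apply/subseq_pmapP => -[[|i [|j [|]]]] //; rewrite subseq_enum_ord /= andbT => ij.
  by case=> ai aj; have e := inj i j _ ai aj; rewrite e ltnn in ij.
apply: (iffP (count_descentsP inj2)) => [tri | [_ tri] x y z].
  split=> //; have lt3 (i j k x y z : 'I_n) : i < j -> j < k ->
      a i = Some x -> a j = Some y -> a k = Some z -> cyc_le x y z.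
    move=> ij jk ai aj ak; apply: tri; apply/subseq_pmapP.
    by exists [:: i; j; k]; rewrite ?subseq_enum_ord /= ?ij ?jk // ai aj ak.
  move=> i j k x y z ai aj ak.
  have [eij|] := eqVneq i j.
    by move: ai; rewrite eij aj => -[<-] _; rewrite /cyc_le ltnn; lia.
  have [ejk|] := eqVneq j k.
    by move: aj; rewrite ejk ak => -[<-] _; rewrite /cyc_le ltnn; lia.
  have [eik|] := eqVneq i k.
    by move: ai; rewrite eik ak => -[<-] _; rewrite /cyc_le ltnn; lia.
  rewrite -!val_eqE /= => ik jk ij; rewrite {1}/cyc_le => c.
  have : [|| (i < j) && (j < k), (j < k) && (k < i) | (k < i) && (i < j)] by lia.
  case/or3P=> /andP[l1 l2].
  - exact: lt3 l1 l2 ai aj ak.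
  - by have := lt3 _ _ _ _ _ _ l1 l2 aj ak ai; rewrite /cyc_le; lia.
  - by have := lt3 _ _ _ _ _ _ l1 l2 ak ai aj; rewrite /cyc_le; lia.
case/subseq_pmapP=> -[|i [|j [|k [|]]]] //; rewrite subseq_enum_ord /= andbT.
move=> /andP[ij jk] [ai aj ak]; apply: tri ai aj ak _; rewrite /cyc_le; lia.
Qed.

Lemma POPI_small n : n <= 2 -> POPI n = symInv n.
Proof.
move=> n2; apply/setP=> a; rewrite inE.
apply/andP/idP => [[]//|aI]; split=> //.
suff : a \in POPI n by rewrite inE => /andP[].
apply/POPI_P; split.
  move=> i j x ai aj; move: aI; rewrite inE => /forallP/(_ i)/forallP/(_ j).
  by rewrite ai aj eqxx /= => /eqP.
by move=> _ _ _ x y z _ _ _ _; rewrite /cyc_le; move: (ltn_ord x) (ltn_ord y) (ltn_ord z); lia.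
Qed.

(** * The monoid of orientation-preserving partial permutations *)

Section PartialMaps.

Variable n : nat.
Implicit Types (a b : PT n) (i j : 'I_n).

Lemma pt_mulE a b i : (a * b) i = obind b (a i).
Proof. by rewrite ffunE. Qed.

Lemma pt_oneE i : (1 : PT n) i = Some i.
Proof. by rewrite ffunE. Qed.

Lemma pt_permE (s : 'S_n) i : pt_perm s i = Some (s i).
Proof. by rewrite ffunE. Qed.

Lemma pt_permM (s t : 'S_n) : pt_perm (s * t) = pt_perm s * pt_perm t.
Proof. by apply/ffunP=> i; rewrite pt_mulE !pt_permE /= pt_permE permM. Qed.

Lemma pt_perm1 : pt_perm 1 = 1 :> PT n.
Proof. by apply/ffunP=> i; rewrite pt_permE pt_oneE perm1. Qed.

Lemma pt_permK (s : 'S_n) : pt_perm s * pt_perm s^-1 = 1.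
Proof. by rewrite -pt_permM mulgV pt_perm1. Qed.

Lemma pt_permVK (s : 'S_n) : pt_perm s^-1 * pt_perm s = 1.
Proof. by rewrite -pt_permM mulVg pt_perm1. Qed.

Lemma pt_perm_inj : injective (@pt_perm n).
Proof. by move=> s t /ffunP e; apply/permP=> i; move: (e i); rewrite !pt_permE => -[]. Qed.

(** The partial identity undefined at [i] only. *)
Definition omit i : PT n := [ffun j => if j == i then None else Some j].

Lemma omitE i j : omit i j = if j == i then None else Some j.
Proof. by rewrite ffunE. Qed.

(** The rank of a product is at most the rank of each factor. *)
Lemma card_im_mull a b : #|pt_im (a * b)| <= #|pt_im a|.
Proof.
apply: leq_trans (leq_imset_card (fun j => odflt j (b j)) (pt_im a)).
apply/subset_leq_card/subsetP=> j; rewrite inE => /existsP[i].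
rewrite pt_mulE; case ai: (a i) => [x|] //= /eqP bx.
by apply/imsetP; exists x; rewrite ?bx // inE; apply/existsP; exists i; rewrite ai.
Qed.

Lemma card_im_mulr a b : #|pt_im (a * b)| <= #|pt_im b|.
Proof.
apply/subset_leq_card/subsetP=> j; rewrite !inE => /existsP[i].
rewrite pt_mulE; case ai: (a i) => [x|] //= bx.
by apply/existsP; exists x.
Qed.

Lemma POPI_inj a i j x : a \in POPI n -> a i = Some x -> a j = Some x -> i = j.
Proof. by case/POPI_P=> H _; apply: H. Qed.

(** The rank of a partial injection is the size of its domain. *)
Lemma card_im_dom a : a \in POPI n -> #|pt_im a| = #|[set i | a i != None]|.
Proof.
move=> aP; rewrite -(card_in_imset (f := fun i => odflt i (a i))) => [|i j].
  congr #|pred_of_set _|; apply/setP=> j; rewrite inE.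
  apply/existsP/imsetP => [[i /eqP ai]|[i]]; first by exists i; rewrite ?inE ai.
  by rewrite inE; case ai: (a i) => [x|] //= _ ->; exists i; rewrite ai.
rewrite !inE; case ai: (a i) => [x|] //; case aj: (a j) => [y|] //= _ _ e.
by apply: POPI_inj aP ai _; rewrite aj e.
Qed.

Lemma POPI_mul a b : a \in POPI n -> b \in POPI n -> a * b \in POPI n.
Proof.
move=> /POPI_P[ia ca] /POPI_P[ib cb]; apply/POPI_P; split.
  move=> i j x; rewrite !pt_mulE; case ai: (a i) => [y|] //= bi.
  case aj: (a j) => [y'|] //= bj; have e := ib _ _ _ bi bj.
  by rewrite -e in aj; apply: ia ai aj.
move=> i j k x y z; rewrite !pt_mulE.
case ai: (a i) => [x'|] //= bx; case aj: (a j) => [y'|] //= bY.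
case ak: (a k) => [z'|] //= bz c.
by apply: cb bx bY bz _; apply: ca ai aj ak c.
Qed.

Lemma POPI_restrict a b :
  a \in POPI n -> (forall i x, b i = Some x -> a i = Some x) -> b \in POPI n.
Proof.
move=> /POPI_P[ia ca] sub; apply/POPI_P; split.
  by move=> i j x /sub ai /sub aj; apply: ia ai aj.
by move=> i j k x y z /sub ai /sub aj /sub ak; apply: ca ai aj ak.
Qed.

(** Strict monotonicity on the domain. *)
Definition pt_monotone a := forall i j x y,
  a i = Some x -> a j = Some y -> i < j -> x < y.

Lemma monotone_POPI a : pt_monotone a -> a \in POPI n.
Proof.
move=> mon; apply/POPI_P; split=> [i j x ai aj|i j k x y z ai aj ak].
  apply/val_inj; case: (ltngtP i j) => // /mon.
    by move/(_ _ _ ai aj); rewrite ltnn.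
  by move/(_ _ _ aj ai); rewrite ltnn.
have mon' i' j' x' y' : a i' = Some x' -> a j' = Some y' -> (i' < j')%N = (x' < y')%N.
  move=> ai' aj'; have := mon _ _ _ _ ai' aj'; have := mon _ _ _ _ aj' ai'.
  case: (ltngtP i' j') => [_ _ /(_ isT)-> // | _ /(_ isT) | /val_inj e]; first lia.
  by move: ai'; rewrite e aj' => -[->]; rewrite ltnn.
by rewrite /cyc_le (mon' _ _ _ _ aj ai) (mon' _ _ _ _ ak aj) (mon' _ _ _ _ ai ak).
Qed.

Lemma POPI1 : 1 \in POPI n.
Proof. by apply: monotone_POPI => i j x y; rewrite !pt_oneE => -[->] [->]. Qed.

Lemma POPI_X a k : a \in POPI n -> a ^+ k \in POPI n.
Proof. by move=> aP; elim: k => [|k IH]; rewrite ?POPI1 // expgS POPI_mul. Qed.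

(** A monotone partial map of an initial segment to itself is the identity
    there: the image of the least point moved down would be a smaller point moved
    down, and the image of the greatest point moved up a greater one. *)
Lemma monotone_segment_id a k :
  pt_monotone a -> (forall i, i < k -> exists2 x : 'I_n, a i = Some x & x < k) ->
  forall i, i < k -> a i = Some i.
Proof.
move=> mon seg.
have up d (i x : 'I_n) : i < d -> i < k -> a i = Some x -> i <= x.
  elim: d i x => // d IH i x id ik ai; rewrite leqNgt; apply/negP=> xi.
  have xk := ltn_trans xi ik; have [y ax _] := seg x xk.
  have := IH x y (leq_trans xi id) xk ax; have := mon _ _ _ _ ax ai xi; lia.
have down d (i x : 'I_n) : k - i < d -> i < k -> a i = Some x -> x <= i.
  elim: d i x => // d IH i x id ik ai; rewrite leqNgt; apply/negP=> ix.
  have [x' ai' xk] := seg i ik; move: ai'; rewrite ai => -[ex]; subst x'.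
  have [y ax _] := seg x xk.
  have := IH x y _ xk ax; have := mon _ _ _ _ ai ax ix; lia.
move=> i ik; have [x ai _] := seg i ik; rewrite ai; congr Some; apply/val_inj.
by apply/eqP; rewrite eqn_leq (down _ i x (leqnn _) ik ai) (up _ i x (leqnn _) ik ai).
Qed.

Lemma cycXE k i : (cyc n ^+ k) i = (i + k) %% n :> nat.
Proof.
elim: k => [|k IH]; first by rewrite expg0 perm1 addn0 modn_small.
by rewrite expgSr permM permE /= IH addnS -addn1 modnDml addn1.
Qed.

Lemma cyc_trans i j : exists2 c, c \in <[cyc n]> & c i = j.
Proof.
exists (cyc n ^+ (j + (n - i))); first exact: mem_cycle.
apply/val_inj; rewrite /= cycXE (_ : _ + _ = j + n)%N; last by have := ltn_ord i; lia.
by rewrite modnDr modn_small.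
Qed.

Lemma cyc_fix c i : c \in <[cyc n]> -> c i = i -> c = 1.
Proof.
case/cycleP=> k -> /(congr1 val); rewrite /= cycXE => e; apply/permP=> j.
have kn : k == 0 %[mod n].
  by rewrite -(eqn_modDl i) e addn0 modn_small.
apply/val_inj; rewrite /= cycXE perm1 -modnDmr.
by rewrite (eqP kn) mod0n addn0 modn_small.
Qed.

Lemma cyc_eq c d i : c \in <[cyc n]> -> d \in <[cyc n]> -> c i = d i -> c = d.
Proof.
move=> cC dC e; apply/eqP; rewrite eq_mulgV1; apply/eqP.
by apply: (cyc_fix (i := i)); rewrite ?groupM ?groupV // permM e permK.
Qed.

Lemma POPI_cyc c : c \in <[cyc n]> -> pt_perm c \in POPI n.
Proof.
case/cycleP=> k ->.
have cycP : pt_perm (cyc n) \in POPI n.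
  apply/POPI_P; split=> [i j x|i j k' x y z]; rewrite !pt_permE.
    by move=> [<-] [/perm_inj].
  have cE (i' : 'I_n) : (cyc n i' : nat) = if i'.+1 == n then 0 else i'.+1.
    rewrite permE /=; case: eqP => [->|]; first exact: modnn.
    by have := ltn_ord i'; move=> ? ?; rewrite modn_small //; lia.
  move=> [<-] [<-] [<-]; rewrite /cyc_le !cE.
  have := ltn_ord i; have := ltn_ord j; have := ltn_ord k'.
  by do 3 case: eqP => ?; lia.
elim: k => [|k IH]; first by rewrite expg0 pt_perm1 POPI1.
by rewrite expgS pt_permM POPI_mul.
Qed.

Lemma CgroupP a :
  reflect (exists2 c, c \in <[cyc n]> & a = pt_perm c) (a \in Cgroup n).
Proof. exact: imsetP. Qed.

Lemma Cgroup_POPI a : a \in Cgroup n -> a \in POPI n.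
Proof. by case/CgroupP=> c cC ->; apply: POPI_cyc. Qed.

Lemma Cgroup_perm (s : 'S_n) : (pt_perm s \in Cgroup n) = (s \in <[cyc n]>).
Proof. by rewrite mem_imset //; apply: pt_perm_inj. Qed.

End PartialMaps.

(** * Elements of rank [n] and [n - 1] *)

(** From here on the degree is written [n = m.+1], so that rank [n - 1] is rank
    [m], and the last point is [ord_max]. *)
Section TopRanks.

Variable m : nat.
Local Notation n := m.+1.
Implicit Types (a : PT n) (i j : 'I_n) (b c d e : 'S_n).

(** The permutation that rotates the first [n - 1] points and fixes the last
    one; [zeta n] is its restriction to these points. *)
Definition zperm : 'S_n := cyc n * tperm ord0 ord_max.

Lemma zpermE i :
  zperm i = (if i == m :> nat then m else if i.+1 == m then 0 else i.+1) :> nat.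
Proof.
have ci : cyc n i = (if i == m :> nat then 0 else i.+1) :> nat.
  rewrite permE /=; case: eqP => [->|]; first exact: modnn.
  by have := ltn_ord i; move=> ? ?; rewrite modn_small //; lia.
rewrite permM; case: tpermP => [e|e|].
- by move: ci; rewrite e /=; case: eqP.
- by move: ci; rewrite e /=; do 2 case: eqP => //; lia.
move=> /eqP; rewrite -val_eqE /= ci => n0 /eqP; rewrite -val_eqE /= ci => nm.
by case: (eqVneq (i : nat) m) n0 nm => //= _ _ /negPf->.
Qed.

Lemma zpermX_max k : (zperm ^+ k) ord_max = ord_max.
Proof. by apply: permX_fix; apply/val_inj; rewrite /= zpermE /= eqxx. Qed.

Lemma zpermXE k i : i < m -> (zperm ^+ k) i = (i + k) %% m :> nat.
Proof.
move=> im; elim: k => [|k IH]; first by rewrite expg0 perm1 addn0 modn_small.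
have m0 := leq_ltn_trans (leq0n i) im.
rewrite expgSr permM zpermE IH addnS -(addn1 (i + k)) -(modnDml (i + k) 1) addn1.
have lm := ltn_pmod (i + k) m0.
case: eqP => [e|_]; first by rewrite e ltnn in lm.
case: eqP => [->|ne]; first by rewrite modnn.
have lt : ((i + k) %% m).+1 < m by rewrite ltn_neqAle lm andbT; apply/eqP.
by rewrite (modn_small lt).
Qed.

Lemma zperm_fix b : b \in <[zperm]> -> b ord_max = ord_max.
Proof. by case/cycleP=> k ->; apply: zpermX_max. Qed.

Lemma order_zperm : 0 < m -> #[zperm] = m.
Proof.
move=> m0; apply/eqP; rewrite eqn_dvd order_dvdn; apply/andP; split.
  apply/eqP/permP=> i; rewrite perm1; apply/val_inj.
  have [im|mi] := ltnP i m; first by rewrite /= zpermXE // modnDr modn_small.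
  rewrite (_ : i = ord_max) ?zpermX_max //.
  by apply/val_inj/eqP; rewrite eqn_leq mi -ltnS ltn_ord.
have := zpermXE #[zperm] (i := ord0) m0.
by rewrite expg_order perm1 /= add0n => /esym/eqP.
Qed.

Lemma order_cyc : #[cyc n] = n.
Proof.
apply/eqP; rewrite eqn_dvd order_dvdn; apply/andP; split.
  by apply/eqP/permP=> i; rewrite perm1; apply/val_inj; rewrite /= cycXE modnDr modn_small.
have := cycXE #[cyc n] (ord0 : 'I_n).
by rewrite expg_order perm1 /= add0n => /esym/eqP.
Qed.

(** The restriction of a permutation to the first [n - 1] points. *)
Definition trunc b : PT n := [ffun i => if i == ord_max then None else Some (b i)].

Lemma truncE b i : trunc b i = if i == ord_max then None else Some (b i).
Proof. by rewrite ffunE. Qed.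

Lemma truncM b c : b ord_max = ord_max -> trunc b * trunc c = trunc (b * c).
Proof.
move=> bm; apply/ffunP=> i; rewrite pt_mulE !truncE; case: eqP => //= im.
by rewrite truncE permM -{1}bm (inj_eq perm_inj); case: eqP.
Qed.

Lemma zetaE : zeta n = trunc zperm.
Proof.
apply/ffunP=> i; rewrite ffunE truncE -val_eqE eqSS /=.
have := ltn_ord i; case: eqP => // im lti; rewrite eqSS.
have := zpermE i; have := ltn_ord (zperm i); case: eqP => // _.
case: eqP => [_|ne] _ zi.
  by rewrite (insubT (fun k => k < n) (ltn0Sn m)); congr Some; apply/val_inj; rewrite /= zi.
have lt : i.+1 < n by lia.
by rewrite (insubT (fun k => k < n) lt); congr Some; apply/val_inj; rewrite /= zi.
Qed.

Lemma zetaX k : zeta n ^+ k.+1 = trunc (zperm ^+ k.+1).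
Proof.
elim: k => [|k IH]; first by rewrite !expg1 zetaE.
by rewrite expgS IH zetaE truncM ?(expgS _ k.+1) // -(expg1 zperm) zpermX_max.
Qed.

Lemma POPI_zeta : zeta n \in POPI n.
Proof.
have zE i x : zeta n i = Some x -> i < m /\ x = (if i.+1 == m then 0 else i.+1) :> nat.
  rewrite zetaE truncE -val_eqE /=; case: eqP => // im [<-]; have := ltn_ord i.
  by rewrite zpermE; case: eqP => //; lia.
apply/POPI_P; split.
  move=> i j x /zE[im xi] /zE[jm xj]; apply/val_inj => /=.
  by move: xi xj; do 2 case: eqP; lia.
move=> i j k x y z /zE[im xi] /zE[jm yj] /zE[km zk].
by rewrite /cyc_le xi yj zk; do 3 case: eqP => ?; lia.
Qed.

Lemma POPI_trunc b : b \in <[zperm]> -> trunc b \in POPI n.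
Proof.
case/cycleP=> k ->; have -> : zperm ^+ k = zperm ^+ (#[zperm].-1 + k).+1.
  by rewrite -addSn prednK ?order_gt0 // expgnDr expg_order mul1g.
by rewrite -zetaX POPI_X // POPI_zeta.
Qed.

(** An element of [POPI n] that fixes the first point is monotone. *)
Lemma POPI_monotone a : a \in POPI n -> a ord0 = Some ord0 -> pt_monotone a.
Proof.
move=> aP a0 i j x y ai aj ij.
have neq0 k z : a k = Some z -> 0 < k -> 0 < z.
  move=> ak k0; rewrite lt0n; apply: contraTN k0 => /eqP z0.
  by rewrite (POPI_inj aP ak (j := ord0)) // a0; congr Some; apply/val_inj.
have y0 := neq0 j y aj (leq_ltn_trans (leq0n _) ij).
have xy : x <> y :> nat.
  by move=> /val_inj e; move: ij; rewrite (POPI_inj aP ai (j := j)) ?ltnn // e.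
have /POPI_P[_ /(_ _ _ _ _ _ _ a0 ai aj)] := aP.
by rewrite /cyc_le /=; lia.
Qed.

(** The total elements of [POPI n] are the rotations. *)
Lemma POPI_total a : a \in POPI n -> (forall i, a i) -> a \in Cgroup n.
Proof.
move=> aP tot; have := tot ord0; case a0: (a ord0) => [x|] // _.
have [c cC cx] := cyc_trans x ord0.
have bP : a * pt_perm c \in POPI n by rewrite POPI_mul // POPI_cyc.
have b0 : (a * pt_perm c) ord0 = Some ord0 by rewrite pt_mulE a0 /= pt_permE cx.
have bseg i : i < n -> exists2 x : 'I_n, (a * pt_perm c) i = Some x & x < n.
  have := tot i; case ai: (a i) => [y|] // _ _; exists (c y) => //.
  by rewrite pt_mulE ai /= pt_permE.
have b1 : a * pt_perm c = 1.
  apply/ffunP=> i; rewrite pt_oneE.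
  exact: (monotone_segment_id (POPI_monotone bP b0) bseg).
apply/CgroupP; exists c^-1; first by rewrite groupV.
by rewrite -[LHS]mulg1 -(pt_permK c) mulgA b1 mul1g.
Qed.

(** Rotate by [c], apply [b] to the first [n - 1] points, rotate by [d]: the
    general form of an element of rank [n - 1]. *)
Definition block c b d : PT n := pt_perm c * trunc b * pt_perm d.

Lemma blockE c b d i :
  block c b d i = if c i == ord_max then None else Some (d (b (c i))).
Proof.
by rewrite !pt_mulE pt_permE /= truncE; case: eqP => //= _; rewrite pt_permE.
Qed.

Lemma POPI_block c b d :
  c \in <[cyc n]> -> b \in <[zperm]> -> d \in <[cyc n]> -> block c b d \in POPI n.
Proof.
move=> cC bz dC.
exact: POPI_mul (POPI_mul (POPI_cyc cC) (POPI_trunc bz)) (POPI_cyc dC).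
Qed.

Lemma card_im_block c b d :
  c \in <[cyc n]> -> b \in <[zperm]> -> d \in <[cyc n]> -> #|pt_im (block c b d)| = m.
Proof.
move=> cC bz dC; rewrite card_im_dom ?POPI_block //.
rewrite (_ : [set i | _] = [set~ c^-1 ord_max]); first by rewrite cardsC1 card_ord.
apply/setP=> i; rewrite !inE blockE -(inj_eq (@perm_inj _ c) i) permKV.
by case: (c i == ord_max).
Qed.

(** The factors are unique: [c] is determined by the point outside the domain,
    [d] by the point outside the image, and then [b] by the map itself. *)
Lemma block_inj c b d c' b' d' :
  c \in <[cyc n]> -> b \in <[zperm]> -> d \in <[cyc n]> ->
  c' \in <[cyc n]> -> b' \in <[zperm]> -> d' \in <[cyc n]> ->
  block c b d = block c' b' d' -> [/\ c = c', b = b' & d = d'].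
Proof.
move=> cC bz dC c'C b'z d'C /ffunP eb.
have cc' : c = c'.
  apply: (cyc_eq (i := c^-1 ord_max)) => //; have := eb (c^-1 ord_max).
  by rewrite !blockE permKV eqxx; case: eqP.
subst c'; have {}eb i : i != ord_max -> d (b i) = d' (b' i).
  by move=> im; have := eb (c^-1 i); rewrite !blockE permKV (negPf im) => -[].
have dd' : d = d'.
  apply: (cyc_eq (i := ord_max)) => //; apply/eqP/negPn/negP=> ne.
  pose i := b^-1 (d^-1 (d' ord_max)).
  have im : i != ord_max.
    apply: contraNneq ne => e; have : d (b i) = d' ord_max by rewrite !permKV.
    by rewrite e (zperm_fix bz) => ->.
  have := eb i im; rewrite {1}/i !permKV => /perm_inj e.
  by case/eqP: im; apply: (@perm_inj _ b'); rewrite -e (zperm_fix b'z).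
subst d'; split=> //; apply/permP=> i.
have [->|/eb/perm_inj //] := eqVneq i ord_max.
by rewrite (zperm_fix bz) (zperm_fix b'z).
Qed.

(** Rotating the missing points of the domain and of the image to the last
    position turns [a] into a cyclic shift of the first [n - 1] points. *)
Lemma POPI_blockP a : 0 < m -> a \in POPI n -> #|pt_im a| = m ->
  exists c b d, [/\ c \in <[cyc n]>, b \in <[zperm]>, d \in <[cyc n]> & a = block c b d].
Proof.
move=> m0 aP ra; have rd := ra; rewrite (card_im_dom aP) in rd.
have /eqP/cards1P[i0 di] : #|~: [set i | a i != None]| = 1%N.
  by have := cardsC [set i | a i != None]; rewrite rd card_ord; lia.
have /eqP/cards1P[j0 dj] : #|~: pt_im a| = 1%N.
  by have := cardsC (pt_im a); rewrite ra card_ord; lia.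
have ai i : (a i == None) = (i == i0).
  by have := in_set1 i i0; rewrite -di !inE negbK => ->.
have aj i x : a i = Some x -> x != j0.
  move=> e; have := in_set1 x j0; rewrite -dj !inE => <-; rewrite negbK.
  by apply/existsP; exists i; rewrite e.
have [c cC ci0] := cyc_trans i0 ord_max; have [d dC dm] := cyc_trans ord_max j0.
pose a0 := pt_perm c^-1 * a * pt_perm d^-1.
have a0P : a0 \in POPI n by rewrite !POPI_mul // POPI_cyc ?groupV.
have a0E i : a0 i = omap (d^-1 : 'S_n) (a (c^-1 i)).
  rewrite !pt_mulE pt_permE /=; case: (a _) => //= x; exact: pt_permE.
have a0N i : (a0 i == None) = (i == ord_max).
  rewrite a0E -ci0 -[i in RHS](permKV c) (inj_eq perm_inj) -ai.
  by case: (a _).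
have a0m i x : a0 i = Some x -> x < m.
  rewrite a0E; case e: (a _) => [y|] //= [<-].
  have : d^-1 y != ord_max.
    by apply: contraNneq (aj _ _ e) => em; rewrite -dm -em permKV.
  by rewrite -val_eqE /=; have := ltn_ord (d^-1 y); lia.
have seg0 i : i < m -> exists2 x : 'I_n, a0 i = Some x & x < m.
  move=> im; have := a0N i; rewrite -val_eqE /= (ltn_eqF im).
  case e: (a0 i) => [x|] // _; exists x => //; exact: a0m e.
have [x a00 xm] := seg0 ord0 m0.
have bz : zperm ^+ x \in <[zperm]> by apply: mem_cycle.
set b := zperm ^+ x in bz; have Vz : b^-1 \in <[zperm]> by rewrite groupV.
have bm := zperm_fix bz; have Vm := zperm_fix Vz.
have a1P : a0 * trunc b^-1 \in POPI n by rewrite POPI_mul // POPI_trunc.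
have b0 : b ord0 = x by apply/val_inj; rewrite /= zpermXE // add0n modn_small.
have ne_max (y : 'I_n) : y < m -> y != ord_max by rewrite -val_eqE /=; lia.
have a10 : (a0 * trunc b^-1) ord0 = Some ord0.
  by rewrite pt_mulE a00 /= truncE (negPf (ne_max x xm)) -b0 permK.
have seg1 i : i < m -> exists2 x : 'I_n, (a0 * trunc b^-1) i = Some x & x < m.
  case/seg0=> y ay /ne_max ym; exists (b^-1 y).
    by rewrite pt_mulE ay /= truncE (negPf ym).
  have : b^-1 y != ord_max by rewrite -Vm (inj_eq perm_inj).
  by rewrite -val_eqE /=; have := ltn_ord (b^-1 y); lia.
have a1 : a0 * trunc b^-1 = omit ord_max.
  apply/ffunP=> i; rewrite omitE; have := a0N i.
  have [_ /eqP e|im _] := eqVneq i ord_max.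
    by rewrite pt_mulE e.
  apply: (monotone_segment_id (POPI_monotone a1P a10) seg1).
  by move: im; rewrite -val_eqE /=; have := ltn_ord i; lia.
have a0b : a0 = trunc b.
  have <- : omit ord_max * trunc b = trunc b.
    apply/ffunP=> i; rewrite pt_mulE omitE truncE.
    by case: eqP => //= /eqP/negPf im; rewrite truncE im.
  rewrite -a1 -mulgA truncM // mulVg; apply/ffunP=> i; rewrite [RHS]pt_mulE.
  case e: (a0 i) => [y|] //=; rewrite truncE perm1.
  by rewrite (negPf (ne_max y (a0m i y e))).
exists c, b, d; split=> //; rewrite /block -a0b /a0 !mulgA pt_permK mul1g.
by rewrite -mulgA pt_permVK mulg1.
Qed.

Lemma POPI_rank_max a : a \in POPI n -> #|pt_im a| = n -> a \in Cgroup n.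
Proof.
move=> aP ra; apply: POPI_total => // i.
have : [set i | a i != None] = setT.
  by apply/eqP; rewrite eqEcard subsetT cardsT card_ord -card_im_dom // ra /=.
by move/setP/(_ i); rewrite !inE; case: (a i).
Qed.

Lemma card_im_Cgroup a : a \in Cgroup n -> #|pt_im a| = n.
Proof.
move=> aC; rewrite card_im_dom ?Cgroup_POPI //; case/CgroupP: aC => c _ ->.
rewrite (_ : [set i | _] = setT) ?cardsT ?card_ord //.
by apply/setP=> i; rewrite !inE pt_permE.
Qed.

Lemma card_im_le a : #|pt_im a| <= n.
Proof. by rewrite -[n in X in _ <= X]card_ord max_card. Qed.

End TopRanks.

(** * Generation by the elements of rank at least [n - 1] *)

Lemma subsemigroupP n (M : {set PT n}) :
  reflect (forall x y, x \in M -> y \in M -> x * y \in M) (subsemigroup M).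
Proof.
apply: (iffP forall_inP) => [H x y xM yM | H x xM].
  exact: (forall_inP (H x xM)).
by apply/forall_inP => y; apply: H.
Qed.

Section Generation.

Variable m : nat.
Local Notation n := m.+1.
Implicit Types (a : PT n) (i j x y : 'I_n).

(** For [x] and [y] distinct, the partial permutation that moves [x] to [y], is
    undefined at [y] and fixes the other points. *)
Definition slide x y : PT n := omit y * pt_perm (tperm x y).

Lemma slideE x y i :
  slide x y i = if i == y then None else Some (if i == x then y else i).
Proof.
rewrite pt_mulE omitE; have [//|iy] := eqVneq i y; rewrite /= pt_permE.
have [->|ix] := eqVneq i x; first by rewrite tpermL.
by rewrite tpermD // eq_sym.
Qed.

Lemma slide_mulE x y a i :
  (slide x y * a) i = if i == y then None else a (if i == x then y else i).
Proof. by rewrite [LHS]pt_mulE slideE; case: eqP. Qed.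

Lemma slide_monotone x y : x = y.+1 :> nat \/ y = x.+1 :> nat -> pt_monotone (slide x y).
Proof.
move=> xy i j i' j'; rewrite !slideE -!val_eqE /=.
do 4 case: ifPn => // ?; move=> [<-] [<-]; lia.
Qed.

Lemma card_im_omit i : #|pt_im (omit i : PT n)| = m.
Proof.
rewrite card_im_dom; last first.
  by apply: POPI_restrict (POPI1 n) _ => j x; rewrite omitE pt_oneE; case: eqP.
rewrite (_ : [set j | _] = [set~ i]) ?cardsC1 ?card_ord //.
by apply/setP=> j; rewrite !inE omitE; case: (j == i).
Qed.

Lemma card_im_slide x y : #|pt_im (slide x y)| = m.
Proof.
apply: etrans (card_im_omit y); apply/eqP; rewrite eqn_leq card_im_mull /=.
suff {1}-> : omit y = slide x y * pt_perm (tperm x y) by apply: card_im_mull.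
by rewrite /slide -mulgA -pt_permM tperm2 pt_perm1 mulg1.
Qed.

Lemma monotone_mul a b : pt_monotone a -> pt_monotone b -> pt_monotone (a * b).
Proof.
move=> ma mb i j x y; rewrite !pt_mulE.
case ai: (a i) => [x'|] //= bx; case aj: (a j) => [y'|] //= bY ij.
exact: mb bx bY (ma _ _ _ _ ai aj ij).
Qed.

(** The total distance by which [a] moves the points of its domain. *)
Definition displacement a : nat :=
  \sum_i (if a i is Some x then (x - i) + (i - x) else 0).

Lemma displacement_slide a i y x : i != y -> a i = Some x -> a y = None ->
  (x - y) + (y - x) < (x - i) + (i - x) ->
  displacement (slide y i * a) < displacement a.
Proof.
move=> iy ai ay lt; rewrite /displacement.
rewrite (bigD1 i) // (bigD1 y) 1?eq_sym //=.
rewrite [X in _ < X](bigD1 i) // [X in _ < _ + X](bigD1 y) 1?eq_sym //=.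
rewrite !slide_mulE eqxx [y == i]eq_sym (negPf iy) eqxx ai ay !add0n.
rewrite (eq_bigr (fun j => if a j is Some x then (x - j) + (j - x) else 0)); last first.
  by move=> j /andP[/negPf ji /negPf jy]; rewrite slide_mulE ji jy.
by rewrite ltn_add2r.
Qed.

(** A monotone partial map that is not a partial identity can be slid: the
    least point moved down, or the greatest point moved up, has a neighbour
    outside the domain that is closer to its image. *)
Lemma monotone_slidable a i x : pt_monotone a -> a i = Some x -> x != i ->
  exists i y x, [/\ a i = Some x, a y = None, i = y.+1 :> nat \/ y = i.+1 :> nat
                  & (x - y) + (y - x) < (x - i) + (i - x)].
Proof.
move=> mon ai; rewrite -val_eqE /= neq_ltn => /orP[xi|ix].
  pose P (k : 'I_n) := if a k is Some w then w < k else false.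
  have Pi : P i by rewrite /P ai.
  case: (arg_minnP (fun k : 'I_n => k : nat) Pi) => {xi Pi ai x} i'.
  rewrite {1}/P; case ai: (a i') => [x|] // xi min.
  have yn : i'.-1 < n by have := ltn_ord i'; lia.
  exists i', (Ordinal yn), x; split; rewrite //=; try lia.
  case ay: (a _) => [w|] //.
  have := mon _ _ _ _ ay ai; have := min (Ordinal yn); rewrite /P ay /=; lia.
pose P (k : 'I_n) := if a k is Some w then k < w else false.
have Pi : P i by rewrite /P ai.
case: (arg_maxnP (fun k : 'I_n => k : nat) Pi) => {ix Pi ai x} i'.
rewrite {1}/P; case ai: (a i') => [x|] // xi max.
have yn : i'.+1 < n by have := ltn_ord x; lia.
exists i', (Ordinal yn), x; split; rewrite //=; try lia.
case ay: (a _) => [w|] //.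
have := mon _ _ _ _ ai ay; have := max (Ordinal yn); rewrite /P ay /=; lia.
Qed.

(** [POPI n] is generated by its elements of rank at least [n - 1]: partial
    identities are products of those of rank [n - 1], monotone maps are reduced
    to partial identities by slides, and rotations make any map monotone. *)
Lemma POPI_generated (N : {set PT n}) : subsemigroup N ->
  (forall a, a \in POPI n -> m <= #|pt_im a| -> a \in N) -> POPI n \subset N.
Proof.
move=> /subsemigroupP NM top; apply/subsetP=> a0 a0P.
have N1 : 1 \in N.
  by rewrite top ?POPI1 // -pt_perm1 card_im_Cgroup // Cgroup_perm group1.
have NC c : c \in <[cyc n]> -> pt_perm c \in N.
  move=> cC; rewrite top ?POPI_cyc // card_im_Cgroup // ; by rewrite Cgroup_perm.
have Nid d a : #|[set i | a i == None]| <= d -> (forall i x, a i = Some x -> x = i) -> a \in N.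
  elim: d a => [|d IH] a.
    rewrite leqn0 cards_eq0 => /eqP/setP tot id; suff -> : a = 1 by [].
    apply/ffunP=> i; rewrite pt_oneE; have := tot i; rewrite !inE.
    by case e: (a i) => [x|] // _; rewrite (id _ _ e).
  have [e |/set0Pn[i]] := eqVneq [set i | a i == None] set0.
    by move=> _ id; apply: IH => //; rewrite e cards0.
  rewrite inE => /eqP ai card id.
  pose a' : PT n := [ffun j => if j == i then Some j else a j].
  have -> : a = omit i * a'.
    apply/ffunP=> j; rewrite pt_mulE omitE; case: eqP => [->//|/eqP/negPf ji] /=.
    by rewrite ffunE ji.
  apply: NM.
    apply: top; last by rewrite card_im_omit.
    by apply: POPI_restrict (POPI1 n) _ => j x; rewrite omitE pt_oneE; case: eqP.
  apply: IH => [|j x]; last by rewrite ffunE; case: eqP => [_ []//|_]; apply: id.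
  rewrite -ltnS; apply: leq_trans card; apply: proper_card; apply/properP; split.
    by apply/subsetP=> j; rewrite !inE ffunE; case: (j == i).
  by exists i; rewrite !inE ?ai // ffunE eqxx.
have Nmon d a : displacement a < d -> pt_monotone a -> a \in N.
  elim: d a => // d IH a disp mon.
  have [i|id] := pickP (fun i => if a i is Some x then x != i else false); last first.
    apply: (Nid _ a (leqnn _)) => i x ai.
    by have := id i; rewrite ai => /negbFE/eqP.
  case ai: (a i) => [x|] //= xi.
  have [i' [y [x' [ai' ay adj lt]]]] := monotone_slidable mon ai xi.
  have iy : i' != y by rewrite -val_eqE /=; case: adj => ->; lia.
  have mon' := slide_monotone adj.
  have mon2 : pt_monotone (slide y i') by apply: slide_monotone; tauto.
  have -> : a = slide i' y * (slide y i' * a).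
    apply/ffunP=> j; rewrite slide_mulE; have [->//|jy] := eqVneq j y.
    have [->|ji] := eqVneq j i'; rewrite slide_mulE.
      by rewrite eq_sym (negPf iy) eqxx.
    by rewrite (negPf ji) (negPf jy).
  apply: NM.
    by apply: top; rewrite ?card_im_slide // monotone_POPI.
  apply: IH; last exact: monotone_mul.
  exact: leq_trans (displacement_slide iy ai' ay lt) disp.
have [i /negbTE ai0|emp] := pickP (fun i => a0 i != None); last first.
  by apply: (Nid _ a0 (leqnn _)) => i x e; have := emp i; rewrite e.
case ai: (a0 i) ai0 => [x|] // _.
have [c cC c0] := cyc_trans ord0 i; have [d dC dx] := cyc_trans x ord0.
pose b := pt_perm c * a0 * pt_perm d.
have bP : b \in POPI n by rewrite !POPI_mul // POPI_cyc.
have b0 : b ord0 = Some ord0 by rewrite !pt_mulE pt_permE /= c0 ai /= pt_permE dx.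
have bN : b \in N := Nmon _ b (ltnSn _) (POPI_monotone bP b0).
have -> : a0 = pt_perm c^-1 * b * pt_perm d^-1.
  by rewrite /b !mulgA pt_permVK mul1g -mulgA pt_permK mulg1.
by apply: (NM _ _ (NM _ _ _ bN)); apply: NC; rewrite groupV.
Qed.

End Generation.

(** * Green's relations *)

Section Green.

Variable n : nat.
Implicit Types (x y s t : PT n).
Local Notation S := (POPI n).

Lemma ideal_subset x y s t : s \in S -> t \in S -> ideal S (s * x * t) \subset ideal S x.
Proof.
move=> sS tS; apply/subsetP=> _ /imset2P[u v uS vS ->].
by apply/imset2P; exists (u * s) (t * v); rewrite ?POPI_mul // !mulgA.
Qed.

Lemma mem_ideal x : x \in ideal S x.
Proof. by apply/imset2P; exists 1 1; rewrite ?POPI1 // mul1g mulg1. Qed.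

(** Being J-related, written with explicit factors instead of ideals. *)
Lemma JclassP x y :
  reflect [/\ y \in S, (exists s t, [/\ s \in S, t \in S & y = s * x * t])
            & (exists s t, [/\ s \in S, t \in S & x = s * y * t])]
    (y \in Jclass S x).
Proof.
have -> : y \in Jclass S x = (y \in S) && (ideal S y == ideal S x) by rewrite in_set.
apply: (iffP andP) => [[yS /eqP e]|[yS [s [t [sS tS ey]]] [u [v [uS vS ex]]]]].
  split=> //.
    by have := mem_ideal y; rewrite e => /imset2P[s t sS tS ->]; exists s, t.
  by have := mem_ideal x; rewrite -e => /imset2P[s t sS tS ->]; exists s, t.
split=> //; rewrite eqEsubset {1}ey [in X in _ && X]ex.
by rewrite !ideal_subset.
Qed.

Lemma mem_Hclass x y u u' v v' : x \in S -> u \in S -> u' \in S -> v \in S -> v' \in S ->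
  x = y * u -> y = x * u' -> x = v * y -> y = v' * x -> x \in Hclass S y.
Proof.
move=> xS uS u'S vS v'S xu yu xv yv.
have rsub b w : w \in S -> rideal S (b * w) \subset rideal S b.
  move=> wS; apply/subsetP=> _ /imsetP[s sS ->].
  by apply/imsetP; exists (w * s); rewrite ?POPI_mul ?mulgA.
have lsub b w : w \in S -> lideal S (w * b) \subset lideal S b.
  move=> wS; apply/subsetP=> _ /imsetP[s sS ->].
  by apply/imsetP; exists (s * w); rewrite ?POPI_mul ?mulgA.
rewrite in_set xS !eqEsubset /=; apply/andP; split; apply/andP; split.
- by rewrite xu rsub.
- by rewrite yu rsub.
- by rewrite xv lsub.
- by rewrite yv lsub.
Qed.

End Green.

(** * Maximal subsemigroups *)

Lemma maximal_subsemigroupP n (S M : {set PT n}) :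
  reflect [/\ subsemigroup M, M \proper S
            & forall N, subsemigroup N -> N \proper S -> M \subset N -> N = M]
    (maximal_subsemigroup S M).
Proof.
apply: (iffP maxsetP) => [[/andP[sM pM] H]|[sM pM H]].
  by split=> // N sN pN; apply: H; rewrite sN.
by split=> [|N /andP[sN pN]]; [rewrite sM | apply: H].
Qed.

Lemma eq_maximal_group (gT : finGroupType) (U V G : {group gT}) :
  maximal U G -> V \proper G -> U \subset V -> V = U :> {set gT}.
Proof. by case/maxgroupP=> _ H pV sUV; apply: H. Qed.

Section Maximal.

Variable m : nat.
Local Notation n := m.+1.
Local Notation S := (POPI n).
Local Notation C := (Cgroup n).
Local Notation J := (rank_eq n m).
Local Notation Cn := <[cyc n]>.
Local Notation Zm := <[zperm m]>.
Implicit Types (a x y : PT n) (b c d : 'S_n) (M N : {set PT n}) (A U V B : {set 'S_n}).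

Lemma CgroupE a : a \in S -> (a \in C) = (#|pt_im a| == n).
Proof.
move=> aS; apply/idP/eqP => [|e]; first exact: card_im_Cgroup.
exact: POPI_rank_max.
Qed.

Lemma Cgroup1 : 1 \in C.
Proof. by rewrite -pt_perm1 Cgroup_perm. Qed.

Lemma Cgroup_mul x y : x \in S -> y \in S -> (x * y \in C) = (x \in C) && (y \in C).
Proof.
move=> xS yS; rewrite !CgroupE ?POPI_mul //.
apply/eqP/andP => [e|[]].
  by split; rewrite eqn_leq card_im_le -{1}e ?card_im_mull ?card_im_mulr.
rewrite -!CgroupE // => /CgroupP[c cC ->] /CgroupP[d dC ->].
by rewrite -pt_permM card_im_Cgroup // Cgroup_perm groupM.
Qed.

(** ** Maximal subsemigroups not containing the group of units *)

(** The subsemigroup obtained by shrinking the group of units to [U]. *)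
Definition unit_type U : {set PT n} := (S :\: C) :|: (@pt_perm n @: U).

Lemma unit_type_perm U c : c \in Cn -> (pt_perm c \in unit_type U) = (c \in U).
Proof.
move=> cC; rewrite inE mem_imset; last exact: pt_perm_inj.
by rewrite inE Cgroup_perm cC.
Qed.

Lemma unit_type_sub U : U \subset Cn -> unit_type U \subset S.
Proof.
move=> /subsetP sU; apply/subsetP=> a; rewrite inE => /orP[/setDP[]//|/imsetP[c /sU cC ->]].
exact: POPI_cyc.
Qed.

Lemma unit_type_semigroup (U : {group 'S_n}) : U \subset Cn -> subsemigroup (unit_type U).
Proof.
move=> sU; have /subsetP sS := unit_type_sub sU; apply/subsemigroupP=> x y xU yU.
have xyS : x * y \in S by rewrite POPI_mul ?sS.
have [xyC|xyC] := boolP (x * y \in C); last by rewrite inE [_ \in _ :\: _]inE xyC xyS.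
have := xyC; rewrite Cgroup_mul ?sS // => /andP[/CgroupP[c cC ex] /CgroupP[d dC ey]].
move: xU yU; rewrite ex ey -pt_permM (unit_type_perm _ cC) (unit_type_perm _ dC).
by rewrite (unit_type_perm _ (groupM cC dC)); apply: groupM.
Qed.

Lemma unit_type_eqS U : U \subset Cn -> (unit_type U == S) = (U == Cn).
Proof.
move=> sU; apply/eqP/eqP => [e|->].
  apply/eqP; rewrite eqEsubset sU; apply/subsetP=> c cC.
  by rewrite -unit_type_perm // e POPI_cyc.
rewrite /unit_type -/(Cgroup n) setDE setUC setUIr setUCr setIT.
by apply/setUidPr/subsetP=> a; apply: Cgroup_POPI.
Qed.

(** A subsemigroup containing all non-units is determined by its units. *)
Lemma unit_type_decomp N : subsemigroup N -> N \subset S -> 1 \in N -> S :\: C \subset N ->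
  exists2 U : {group 'S_n}, U \subset Cn & N = unit_type U.
Proof.
move=> /subsemigroupP NM /subsetP NS N1 /subsetP CN.
pose V := [set c in Cn | pt_perm c \in N].
have gV : group_set V.
  apply: group_set_closed => [|c d].
    by apply/set0Pn; exists 1; rewrite inE group1 pt_perm1.
  by rewrite !inE => /andP[cC cN] /andP[dC dN]; rewrite groupM //= pt_permM NM.
exists (Group gV); first by apply/subsetP=> c; rewrite inE => /andP[].
apply/setP=> a; have [/CgroupP[c cC ->]|aC] := boolP (a \in C).
  by rewrite unit_type_perm //= inE cC.
rewrite inE [a \in _ :\: _]inE aC /=; apply/idP/orP => [/NS aS|]; first by left.
case=> [aS|/imsetP[c]]; first by apply: CN; rewrite inE aC.
by rewrite inE => /andP[_ cN] ->.
Qed.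

Lemma unit_type_subset U V : U \subset Cn -> unit_type U \subset unit_type V -> U \subset V.
Proof.
move=> /subsetP sU /subsetP s; apply/subsetP=> c cU.
by rewrite -unit_type_perm ?sU // s // unit_type_perm ?sU.
Qed.

Lemma unit_type_maximal (U : {group 'S_n}) :
  maximal U Cn -> maximal_subsemigroup S (unit_type U).
Proof.
move=> maxU; have pU := maxgroupp maxU; have sU := proper_sub pU.
apply/maximal_subsemigroupP; split; first exact: unit_type_semigroup.
  by rewrite properEneq unit_type_sub // andbT unit_type_eqS // proper_neq.
move=> N sN pN UN.
have N1 : 1 \in N.
  by apply: (subsetP UN); rewrite -pt_perm1 unit_type_perm ?group1.
have CN : S :\: C \subset N by apply: subset_trans UN; apply: subsetUl.
have [V sV eN] := unit_type_decomp sN (proper_sub pN) N1 CN.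
rewrite eN; congr unit_type; apply: (eq_maximal_group maxU).
  by rewrite properEneq sV andbT -unit_type_eqS // -eN proper_neq.
by apply: unit_type_subset => //; rewrite -eN.
Qed.

Lemma maximal_not_containing_units M : 0 < m ->
  maximal_subsemigroup S M -> ~~ (C \subset M) ->
  exists2 U : {group 'S_n}, maximal U Cn & M = unit_type U.
Proof.
move=> m0 /maximal_subsemigroupP[sM pM max] nC.
have /subsemigroupP MM := sM; have MS := proper_sub pM.
have ideal x y : x \in S -> y \in S -> x * y \in C -> x \in C /\ y \in C.
  by move=> xS yS; rewrite Cgroup_mul // => /andP.
(* Adjoining all non-units and the identity to M keeps it proper: otherwise M
   would contain the generator of the group of units, hence all units. *)
pose N1 := (S :\: C) :|: ((1 : PT n) |: M).
have N1S : N1 \subset S.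
  by rewrite !subUset subsetDl MS sub1set POPI1.
have sN1 : subsemigroup N1.
  apply/subsemigroupP=> x y xN yN; have xS := subsetP N1S x xN; have yS := subsetP N1S y yN.
  have [xyC|xyC] := boolP (x * y \in C); last by rewrite inE [_ \in _ :\: _]inE xyC POPI_mul.
  have [xC yC] := ideal x y xS yS xyC.
  move: xN yN; rewrite !inE xC yC /=.
  case/orP=> [/eqP->|xM]; first by rewrite mul1g => ->; rewrite orbT.
  case/orP=> [/eqP->|yM]; first by rewrite mulg1 xM !orbT.
  by rewrite MM ?orbT.
have MN1 : M \subset N1 by rewrite /N1 setUA subsetUr.
have pN1 : N1 \proper S.
  rewrite properEneq N1S andbT; apply: contraNneq nC => eN.
  have cM : pt_perm (cyc n) \in M.
    have : pt_perm (cyc n) \in N1 by rewrite eN POPI_cyc // cycle_id.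
    rewrite !inE Cgroup_perm cycle_id /= -pt_perm1 (inj_eq (@pt_perm_inj n)).
    by rewrite -order_eq1 order_cyc eqSS (gtn_eqF m0).
  have cXM k : pt_perm (cyc n ^+ k.+1) \in M.
    by elim: k => [|k IH]; rewrite ?expg1 // expgS pt_permM MM.
  apply/subsetP=> _ /CgroupP[_ /cycleP[k ->] ->].
  have -> : cyc n ^+ k = cyc n ^+ (m + k).+1; last exact: cXM.
  have e : cyc n ^+ n = 1 by apply/eqP; rewrite -order_dvdn order_cyc.
  by rewrite -addSn expgnDr e mul1g.
have eM := max _ sN1 pN1 MN1.
have M1 : 1 \in M by rewrite -eM !inE eqxx orbT.
have CM : S :\: C \subset M by rewrite -eM subsetUl.
have [U sU eU] := unit_type_decomp sM MS M1 CM.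
exists U => //; apply/maxgroupP; split.
  by rewrite properEneq sU andbT -unit_type_eqS // -eU proper_neq.
move=> V pV sUV; have sV := proper_sub pV; apply/eqP; rewrite eqEsubset sUV andbT.
apply: unit_type_subset => //; rewrite -eU (max (unit_type V)) //.
- exact: unit_type_semigroup.
- by rewrite properEneq unit_type_sub // andbT unit_type_eqS // proper_neq.
- by rewrite eU setUS // imsetS.
Qed.

(** The J-class of the identity is the group of units. *)
Lemma Jclass_Cgroup x : x \in Jclass S 1 = (x \in C).
Proof.
apply/JclassP/idP => [[xS _ [s [t [sS tS e]]]]|xC].
  by have := Cgroup1; rewrite e !Cgroup_mul ?POPI_mul // => /andP[/andP[]].
have xS := Cgroup_POPI xC; split=> //.
  by exists x, 1; rewrite !mulg1 POPI1.
have /CgroupP[c cC ex] := xC.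
by exists (pt_perm c^-1), 1; rewrite mulg1 ex pt_permVK POPI1 POPI_cyc ?groupV.
Qed.

Lemma unit_type_M5 (U : {group 'S_n}) : maximal U Cn -> type_M5 S (unit_type U).
Proof.
move=> maxU; split; first exact: unit_type_maximal.
have sU := proper_sub (maxgroupp maxU).
exists 1; first exact: POPI1.
split=> [x|| x]; rewrite ?Jclass_Cgroup.
- case/CgroupP=> c cC ->; apply/exists_inP; exists (pt_perm c^-1).
    by rewrite POPI_cyc ?groupV.
  by rewrite pt_permK mul1g.
- apply/subsetP=> x; rewrite Jclass_Cgroup => /setDP[xS].
  by rewrite inE negb_or [_ \in _ :\: _]inE xS andbT negbK => /andP[].
move=> xC; apply/set0Pn; exists 1; rewrite inE inE Jclass_Cgroup Cgroup1 andbT.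
rewrite -{1}pt_perm1 unit_type_perm ?group1 //=.
have /CgroupP[c cC ex] := xC; have xS := Cgroup_POPI xC.
have cVS : pt_perm c^-1 \in S by rewrite POPI_cyc ?groupV.
apply: (mem_Hclass (u := pt_perm c^-1) (u' := x) (v := pt_perm c^-1) (v' := x)); rewrite ?POPI1 //.
- by rewrite ex pt_permK.
- by rewrite mul1g.
- by rewrite ex pt_permVK.
- by rewrite mulg1.
Qed.

End Maximal.

Section Zeta.

Variable m : nat.
Local Notation n := m.+1.
Local Notation S := (POPI n).
Local Notation C := (Cgroup n).
Local Notation J := (rank_eq n m).
Local Notation Cn := <[cyc n]>.
Local Notation Zm := <[zperm m]>.
Implicit Types (a x y : PT n) (b c d : 'S_n) (M N : {set PT n}) (A U V B : {set 'S_n}).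

(** ** Maximal subsemigroups containing the group of units *)

(** The elements of [POPI n] whose middle factor, when they have rank [n - 1],
    lies in [B]; elements of other ranks are not of the form [block c b d] and
    are not restricted. *)
Definition top_type B : {set PT n} :=
  [set a in S | [forall c in Cn, forall b in Zm, forall d in Cn,
                   (a == block c b d) ==> (b \in B)]].

Lemma top_typeP B a :
  reflect (a \in S /\ forall c b d, c \in Cn -> b \in Zm -> d \in Cn ->
                        a = block c b d -> b \in B)
    (a \in top_type B).
Proof.
have -> : a \in top_type B = (a \in S) && [forall c in Cn, forall b in Zm,
    forall d in Cn, (a == block c b d) ==> (b \in B)] by rewrite in_set.
apply: (iffP andP) => -[aS H]; split=> //.
  move=> c b d cC bz dC e; have := forall_inP (forall_inP (forall_inP H c cC) b bz) d dC.
  by rewrite e eqxx.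
apply/forall_inP=> c cC; apply/forall_inP=> b bz; apply/forall_inP=> d dC.
by apply/implyP=> /eqP; apply: H.
Qed.

Lemma top_type_block B c b d : c \in Cn -> b \in Zm -> d \in Cn ->
  (block c b d \in top_type B) = (b \in B).
Proof.
move=> cC bz dC; apply/top_typeP/idP => [[_ /(_ c b d)]|bB]; first exact.
split=> [|c' b' d' c'C b'z d'C]; first exact: POPI_block.
by case/(block_inj cC bz dC c'C b'z d'C) => _ <-.
Qed.

Lemma block11 b : block 1 b 1 = trunc b.
Proof. by rewrite /block pt_perm1 mul1g mulg1. Qed.

Lemma top_type_trunc B b : b \in Zm -> (trunc b \in top_type B) = (b \in B).
Proof. by move=> bz; rewrite -block11 top_type_block. Qed.

Lemma top_type_sub B : top_type B \subset S.
Proof. by apply/subsetP=> a /top_typeP[]. Qed.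

Lemma rank_neq_top_type B a : a \in S -> #|pt_im a| != m -> a \in top_type B.
Proof.
move=> aS ra; apply/top_typeP; split=> // c b d cC bz dC e.
by rewrite e card_im_block ?eqxx in ra.
Qed.

Lemma top_type_semigroup (B : {group 'S_n}) : 0 < m -> B \subset Zm -> subsemigroup (top_type B).
Proof.
move=> m0 /subsetP sB; have /subsetP sS := top_type_sub B.
apply/subsemigroupP=> x y xB yB; have xS := sS _ xB; have yS := sS _ yB.
apply/top_typeP; split=> [|c b d cC bz dC exy]; first exact: POPI_mul.
have rxy := card_im_block cC bz dC; rewrite -exy in rxy.
have [rx ry] : m <= #|pt_im x| /\ m <= #|pt_im y|.
  have le := eq_leq (esym rxy).
  by split; [apply: leq_trans le (card_im_mull x y) | apply: leq_trans le (card_im_mulr x y)].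
have [xC|xC] := boolP (x \in C).
  have /CgroupP[u uC ex] := xC.
  have ey : y = block (u^-1 * c) b d.
    have -> : block (u^-1 * c) b d = pt_perm u^-1 * (x * y).
      by rewrite exy /block pt_permM !mulgA.
    by rewrite ex mulgA pt_permVK mul1g.
  by rewrite -(top_type_block B (c := u^-1 * c) (d := d)) ?groupM ?groupV // -ey.
have [yC|yC] := boolP (y \in C).
  have /CgroupP[u uC ey] := yC.
  have ex : x = block c b (d * u^-1).
    have -> : block c b (d * u^-1) = x * y * pt_perm u^-1.
      by rewrite exy /block pt_permM !mulgA.
    by rewrite ey -mulgA pt_permK mulg1.
  by rewrite -(top_type_block B (c := c) (d := d * u^-1)) ?groupM ?groupV // -ex.
have eq_m a : a \in S -> a \notin C -> m <= #|pt_im a| -> #|pt_im a| = m.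
  by move=> aS; rewrite CgroupE // => na ra; have := card_im_le a; lia.
have [c1 [b1 [d1 [c1C b1z d1C ex]]]] := POPI_blockP m0 xS (eq_m x xS xC rx).
have [c2 [b2 [d2 [c2C b2z d2C ey]]]] := POPI_blockP m0 yS (eq_m y yS yC ry).
have b1B : b1 \in B by rewrite -(top_type_block B c1C b1z d1C) -ex.
have b2B : b2 \in B by rewrite -(top_type_block B c2C b2z d2C) -ey.
(* Unless the inner units cancel, the product is undefined at two points. *)
have e1 : d1 * c2 = 1.
  apply: (cyc_fix (i := ord_max)); first exact: groupM.
  pose i := c1^-1 (b1^-1 ((d1 * c2)^-1 ord_max)).
  have xyN (j : 'I_n) : (x * y) j = None -> c j = ord_max.
    by rewrite exy blockE; case: eqP.
  have ci : c i = ord_max.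
    apply: xyN; rewrite pt_mulE ex blockE; case: eqP => //= _.
    by rewrite ey blockE /i !permKV -permM permKV eqxx.
  have cj : c (c1^-1 ord_max) = ord_max.
    by apply: xyN; rewrite pt_mulE ex blockE permKV eqxx.
  have : i = c1^-1 ord_max by apply: (@perm_inj _ c); rewrite ci cj.
  move/perm_inj => e; have {}e : (d1 * c2)^-1 ord_max = ord_max.
    by rewrite -[LHS](permKV b1) e (zperm_fix b1z).
  by rewrite -{1}e permKV.
have eb : block c b d = block c1 (b1 * b2) d2.
  rewrite -exy ex ey /block -truncM ?(zperm_fix b1z) // !mulgA.
  by rewrite -(mulgA _ (pt_perm d1)) -pt_permM e1 pt_perm1 mulg1.
have [_ -> _] := block_inj cC bz dC c1C (groupM b1z b2z) d2C eb.
exact: groupM.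
Qed.

Lemma top_type_eqS B : B \subset Zm -> (top_type B == S) = (B == Zm).
Proof.
move=> sB; apply/eqP/eqP => [e|->]; apply/eqP; rewrite eqEsubset.
  rewrite sB; apply/subsetP=> b bz.
  by rewrite -top_type_trunc // e POPI_trunc.
by rewrite top_type_sub; apply/subsetP=> a aS; apply/top_typeP.
Qed.

Lemma top_type_subset U V : U \subset Zm -> top_type U \subset top_type V -> U \subset V.
Proof.
move=> /subsetP sU /subsetP s; apply/subsetP=> b bU.
by rewrite -top_type_trunc ?sU // s // top_type_trunc ?sU.
Qed.

(** A subsemigroup containing all elements of rank other than [n - 1] and one
    element of rank [n - 1] is determined by the middle factors it contains. *)
Lemma top_type_decomp N x : 0 < m -> subsemigroup N -> N \subset S ->
  S :\: J \subset N -> x \in N -> x \in J ->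
  exists2 B : {group 'S_n}, B \subset Zm & N = top_type B.
Proof.
move=> m0 /subsemigroupP NM /subsetP NS /subsetP KN xN xJ.
have CN c : c \in Cn -> pt_perm c \in N.
  move=> cC; apply: KN; rewrite inE POPI_cyc // andbT inE.
  by rewrite card_im_Cgroup ?Cgroup_perm // -[X in _ != X]addn0 -addn1 eqn_add2l.
have Ntrunc c b d : c \in Cn -> d \in Cn -> (block c b d \in N) = (trunc b \in N).
  move=> cC dC; apply/idP/idP => [bN|tN]; last first.
    exact: NM _ _ (NM _ _ (CN _ cC) tN) (CN _ dC).
  have -> : trunc b = pt_perm c^-1 * block c b d * pt_perm d^-1.
    by rewrite /block !mulgA pt_permVK mul1g -mulgA pt_permK mulg1.
  by rewrite (NM _ _ (NM _ _ (CN _ _) bN) (CN _ _)) ?groupV.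
pose V := [set b in Zm | trunc b \in N].
have gV : group_set V.
  apply: group_set_closed => [|b e].
    rewrite inE in xJ.
    have [c [b [d [cC bz dC ex]]]] := POPI_blockP m0 (NS _ xN) (eqP xJ).
    by apply/set0Pn; exists b; rewrite inE bz -(Ntrunc c b d) // -ex.
  rewrite !inE => /andP[bz bN] /andP[ez eN].
  by rewrite groupM //= -truncM ?(zperm_fix bz) // NM.
exists (Group gV); first by apply/subsetP=> b; rewrite inE => /andP[].
apply/setP=> a; have [aS|aS] := boolP (a \in S); last first.
  rewrite (contraNF (NS a) aS); apply/esym.
  exact: (contraNF (subsetP (top_type_sub _) a) aS).
have [ra|ra] := eqVneq #|pt_im a| m; last first.
  by rewrite rank_neq_top_type // KN // inE aS inE ra.
have [c [b [d [cC bz dC ->]]]] := POPI_blockP m0 aS ra.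
by rewrite Ntrunc // top_type_block // inE bz.
Qed.

Lemma top_type_maximal (B : {group 'S_n}) : 0 < m ->
  maximal B Zm -> maximal_subsemigroup S (top_type B).
Proof.
move=> m0 maxB; have pB := maxgroupp maxB; have sB := proper_sub pB.
apply/maximal_subsemigroupP; split; first exact: top_type_semigroup.
  by rewrite properEneq top_type_sub // andbT top_type_eqS // proper_neq.
move=> N sN pN BN.
have KN : S :\: J \subset N.
  apply: subset_trans BN; apply/subsetP=> a /setDP[aS]; rewrite inE.
  exact: rank_neq_top_type.
have tN : trunc 1 \in N by apply: (subsetP BN); rewrite top_type_trunc ?group1.
have tJ : trunc 1 \in J by rewrite inE -block11 card_im_block.
have [V sV eN] := top_type_decomp m0 sN (proper_sub pN) KN tN tJ.
rewrite eN; congr top_type; apply: (eq_maximal_group maxB).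
  by rewrite properEneq sV andbT -top_type_eqS // -eN proper_neq.
by apply: top_type_subset => //; rewrite -eN.
Qed.

Lemma maximal_containing_units M : 1 < m ->
  maximal_subsemigroup S M -> C \subset M ->
  exists2 B : {group 'S_n}, maximal B Zm & M = top_type B.
Proof.
move=> m1 /maximal_subsemigroupP[sM pM max] /subsetP CM.
have m0 := ltnW m1.
have /subsemigroupP MM := sM; have MS := proper_sub pM; have /subsetP MSP := MS.
(* The elements of rank below n - 1 form an ideal, and together with the others
   they generate everything, so they can be adjoined to M. *)
pose K := [set a in S | #|pt_im a| < m].
have KP a : (a \in K) = (a \in S) && (#|pt_im a| < m) by rewrite in_set.
have KM : K \subset M.
  have NS : K :|: M \subset S.
    by rewrite subUset MS andbT; apply/subsetP=> a; rewrite KP => /andP[].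
  suff <- : K :|: M = M by apply: subsetUl.
  apply: max; last exact: subsetUr.
    apply/subsemigroupP=> x y xN yN; rewrite in_setU KP.
    rewrite POPI_mul ?(subsetP NS) //=; move: xN yN; rewrite !in_setU !KP.
    have rx := card_im_mull x y; have ry := card_im_mulr x y.
    case/orP=> [/andP[_ lx]|xM]; first by rewrite (leq_ltn_trans rx lx).
    case/orP=> [/andP[_ ly]|yM]; first by rewrite (leq_ltn_trans ry ly).
    by rewrite MM ?orbT.
  rewrite properEneq NS andbT; apply: contraTneq pM => eN.
  rewrite properE MS negbK /=; apply: POPI_generated => // a aS ra.
  have : a \in K :|: M by rewrite eN.
  by rewrite in_setU KP ltnNge ra andbF.
have KJM : S :\: J \subset M.
  apply/subsetP=> a /setDP[aS]; rewrite inE => na.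
  have [/CM//|] := boolP (a \in C); rewrite CgroupE // => nC.
  by apply: (subsetP KM); rewrite KP aS; have := card_im_le a; lia.
have Zprime : pdiv m \in primes #[zperm m].
  by rewrite order_zperm // mem_primes pdiv_prime // m0 pdiv_dvd.
have [x xM xJ] : exists2 x, x \in M & x \in J.
  apply/exists_inP; apply: contraT => /negP nJ.
  have maxB : maximal <[zperm m ^+ pdiv m]> Zm by apply/maximal_cycleP; exists (pdiv m).
  have /maximal_subsemigroupP[sB pB _] := top_type_maximal m0 maxB.
  have MB : M \subset top_type <[zperm m ^+ pdiv m]>.
    apply/subsetP=> a aM; apply: rank_neq_top_type; first exact: MSP.
    by apply/eqP=> ra; case: nJ; apply/exists_inP; exists a; rewrite // inE ra.
  have eM := max _ sB pB MB; case: nJ; apply/exists_inP; exists (trunc 1).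
    by rewrite -eM top_type_trunc ?group1.
  by rewrite inE -block11 card_im_block.
have [B sB eB] := top_type_decomp m0 sM MS KJM xM xJ.
exists B => //; apply/maxgroupP; split.
  by rewrite properEneq sB andbT -top_type_eqS // -eB proper_neq.
move=> V pV sBV; have sV := proper_sub pV; apply/eqP; rewrite eqEsubset sBV andbT.
apply: top_type_subset => //; rewrite -eB (max (top_type V)) //.
- exact: top_type_semigroup.
- by rewrite properEneq top_type_sub // andbT top_type_eqS // proper_neq.
rewrite eB; apply/subsetP=> a /top_typeP[aS H]; apply/top_typeP; split=> // c b d cC bz dC e.
exact: (subsetP sBV) (H c b d cC bz dC e).
Qed.

(** The generators include all units, so the middle factors that occur form the
    group generated by that of [zeta n ^+ p]. *)
Lemma gen_zeta p : 0 < m -> 0 < p ->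
  gen_subsemigroup ((S :\: J) :|: [set zeta n ^+ p]) = top_type <[zperm m ^+ p]>.
Proof.
move=> m0; case: p => // p _; set z := zperm m ^+ p.+1.
have zZ : z \in Zm by apply: mem_cycle.
have sz : <[z]> \subset Zm by apply: cycleX.
rewrite zetaX -/z; set A := _ :|: _.
have sA : A \subset top_type <[z]>.
  apply/subsetP=> a; rewrite in_setU in_set1 => /orP[/setDP[aS]|/eqP->].
    by rewrite inE; apply: rank_neq_top_type.
  by rewrite top_type_trunc // cycle_id.
apply/eqP; rewrite eqEsubset; apply/andP; split.
  by apply: bigcap_inf; rewrite sA andbT; apply: top_type_semigroup.
apply/bigcapsP=> M /andP[sM AM].
(* The intersection with S puts the decomposition of subsemigroups of S to use. *)
pose N := M :&: S.
have sN : subsemigroup N.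
  move/subsemigroupP: sM => MM; apply/subsemigroupP=> x y /setIP[xM xS] /setIP[yM yS].
  by apply/setIP; rewrite MM ?POPI_mul.
have AN : A \subset N by rewrite subsetI AM (subset_trans sA) ?top_type_sub.
have KN : S :\: J \subset N by apply: subset_trans AN; apply: subsetUl.
have zN : trunc z \in N by apply: (subsetP AN); rewrite in_setU in_set1 eqxx orbT.
have zJ : trunc z \in J by rewrite inE -block11 card_im_block.
have [B sB eB] := top_type_decomp m0 sN (subsetIr _ _) KN zN zJ.
have sNM : N \subset M by apply: subsetIl.
apply: subset_trans sNM; rewrite eB; apply/subsetP=> a /top_typeP[aS H].
apply/top_typeP; split=> // c b d cC bz dC e.
apply: (subsetP _ _ (H c b d cC bz dC e)); rewrite cycle_subG.
by rewrite -top_type_trunc // -eB.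
Qed.

(** The elements of rank [n - 1] form a single J-class. *)
Lemma Jclass_trunc1 x : 0 < m -> x \in Jclass S (trunc 1) = (x \in S) && (x \in J).
Proof.
move=> m0; have tS : trunc 1 \in S by rewrite POPI_trunc.
have rt : #|pt_im (trunc 1 : PT n)| = m by rewrite -block11 card_im_block.
have rank s y t : #|pt_im (s * y * t)| <= #|pt_im y|.
  exact: leq_trans (card_im_mull _ _) (card_im_mulr _ _).
rewrite [x \in J]in_set; apply/JclassP/andP.
  case=> xS [s [t [_ _ ex]]] [u [v [_ _ et]]]; split=> //.
  have := rank s (trunc 1) t; have := rank u x v.
  by rewrite -ex -et rt eqn_leq => -> ->.
case=> xS /eqP rx; have [c [b [d [cC bz dC ex]]]] := POPI_blockP m0 xS rx.
have bVz : b^-1 \in Zm by rewrite groupV.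
have tb : trunc b = trunc 1 * trunc b by rewrite truncM ?mul1g ?perm1.
split=> //.
  exists (pt_perm c), (trunc b * pt_perm d); rewrite POPI_cyc //.
  rewrite (POPI_mul (POPI_trunc bz) (POPI_cyc dC)); split=> //.
  by rewrite ex /block {1}tb !mulgA.
exists (pt_perm c^-1), (pt_perm d^-1 * trunc b^-1).
rewrite POPI_cyc ?groupV // (POPI_mul (POPI_cyc _) (POPI_trunc bVz)) ?groupV //.
split=> //; rewrite ex /block !mulgA pt_permVK mul1g -(mulgA (trunc b)) pt_permK mulg1.
by rewrite truncM ?mulgV // (zperm_fix bz).
Qed.

Lemma top_type_M5 (B : {group 'S_n}) : 0 < m -> maximal B Zm -> type_M5 S (top_type B).
Proof.
move=> m0 maxB; split; first exact: top_type_maximal.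
have blockV c b d : b \in Zm -> block c b d * block d^-1 b^-1 c^-1 = block c 1 c^-1.
  move=> bz; rewrite /block !mulgA -(mulgA _ (pt_perm d)) pt_permK mulg1.
  by rewrite -(mulgA _ (trunc b)) truncM ?mulgV // (zperm_fix bz).
have block1l c b d : block c 1 c^-1 * block c b d = block c b d.
  rewrite /block !mulgA -(mulgA _ (pt_perm c^-1)) pt_permVK mulg1.
  by rewrite -(mulgA _ (trunc 1)) truncM ?mul1g ?perm1.
exists (trunc 1); first by rewrite POPI_trunc.
split=> [x|| x]; rewrite ?Jclass_trunc1 //.
- case/andP=> xS; rewrite inE => /eqP rx.
  have [c [b [d [cC bz dC ->]]]] := POPI_blockP m0 xS rx.
  apply/exists_inP; exists (block d^-1 b^-1 c^-1); first by rewrite POPI_block ?groupV.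
  by rewrite blockV // block1l.
- apply/subsetP=> x /setDP[xS]; rewrite Jclass_trunc1 // xS [_ \in rank_eq _ _]in_set.
  by apply: contraNT; apply: rank_neq_top_type.
case/andP=> xS; rewrite inE => /eqP rx; apply/set0Pn.
have [c [b [d [cC bz dC ->]]]] := POPI_blockP m0 xS rx.
have bVz : b^-1 \in Zm by rewrite groupV.
have yS : block c 1 d \in S by rewrite POPI_block.
(* Same domain and image as x, with trivial middle factor. *)
exists (block c 1 d); rewrite inE [_ \in _ :&: _]inE Jclass_trunc1 // yS.
rewrite top_type_block // group1 inE card_im_block // eqxx /=.
have mulr b1 b2 : b1 \in Zm -> block c b1 d * block d^-1 b2 d = block c (b1 * b2) d.
  move=> b1z; rewrite /block !mulgA -(mulgA _ (pt_perm d)) pt_permK mulg1.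
  by rewrite -(mulgA _ (trunc b1)) truncM // (zperm_fix b1z).
have mull b1 b2 : b1 \in Zm -> block c b1 c^-1 * block c b2 d = block c (b1 * b2) d.
  move=> b1z; rewrite /block !mulgA -(mulgA _ (pt_perm c^-1)) pt_permVK mulg1.
  by rewrite -(mulgA _ (trunc b1)) truncM // (zperm_fix b1z).
by apply: (mem_Hclass (u := block d^-1 b^-1 d) (u' := block d^-1 b d)
  (v := block c b^-1 c^-1) (v' := block c b c^-1));
  rewrite ?POPI_block ?groupV ?mulr ?mull ?mulgV ?mulVg ?mul1g ?mulg1.
Qed.

Lemma unit_type_neq_top_type (U : {group 'S_n}) B :
  U \proper Cn -> unit_type U != top_type B.
Proof.
move=> /properP[_ [c cC cU]]; apply: contraNneq cU => e.
rewrite -unit_type_perm // e rank_neq_top_type ?POPI_cyc //.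
by rewrite card_im_Cgroup ?Cgroup_perm // -[X in _ != X]addn0 -addn1 eqn_add2l.
Qed.

End Zeta.

Theorem theorem3p15 :
  (forall n : nat, 3 <= n ->
     let typeA (U : {group 'S_n}) : {set PT n} :=
       (POPI n :\: Cgroup n) :|: (@pt_perm n @: U) in
     let typeB (p : nat) : {set PT n} :=
       gen_subsemigroup ((POPI n :\: rank_eq n n.-1) :|: [set zeta n ^+ p]) in
     [/\ forall M : {set PT n},
           maximal_subsemigroup (POPI n) M <->
           (exists2 U : {group 'S_n}, maximal U <[cyc n]> & M = typeA U) \/
           (exists2 p : nat, p \in primes n.-1 & M = typeB p),
         forall U : {group 'S_n}, maximal U <[cyc n]> ->
           type_M5 (POPI n) (typeA U),
         forall p : nat, p \in primes n.-1 -> type_M5 (POPI n) (typeB p)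
       & #|[set M : {set PT n} | maximal_subsemigroup (POPI n) M]| =
         (size (primes n) + size (primes n.-1))%N]) /\
  (forall n : nat, n = 1%N \/ n = 2%N -> POPI n = symInv n).
Proof.
split=> [[//|m] m1 typeA typeB|n]; last by case=> ->; apply: POPI_small.
have m0 : 0 < m := ltnW m1; have oz := order_zperm m0; have oc := order_cyc m.
have typeBE p : p \in primes m -> typeB p = top_type <[zperm m ^+ p]>.
  by rewrite mem_primes => /andP[/prime_gt0 p0 _]; apply: gen_zeta.
have maxB p : p \in primes m -> maximal <[zperm m ^+ p]> <[zperm m]>.
  by move=> pm; apply/maximal_cycleP; exists p; rewrite ?oz.
have maxA p : p \in primes m.+1 -> maximal <[cyc m.+1 ^+ p]> <[cyc m.+1]>.
  by move=> pm; apply/maximal_cycleP; exists p; rewrite ?oc.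
have main M : maximal_subsemigroup (POPI m.+1) M <->
    (exists2 U : {group 'S_m.+1}, maximal U <[cyc m.+1]> & M = typeA U) \/
    (exists2 p : nat, p \in primes m & M = typeB p).
  split=> [maxM|[[U maxU ->]|[p pm ->]]].
  - have [CM|nCM] := boolP (Cgroup m.+1 \subset M); last first.
      by left; apply: maximal_not_containing_units.
    have [B /maximal_cycleP[p pz ->] ->] := maximal_containing_units m1 maxM CM.
    by rewrite oz in pz; right; exists p; rewrite ?typeBE.
  - exact: unit_type_maximal.
  - by rewrite typeBE //; apply: top_type_maximal => //; apply: maxB.
split=> // [U|p pm|]; first exact: unit_type_M5.
  by rewrite typeBE //; apply: top_type_M5 => //; apply: maxB.
pose L := [seq typeA <[cyc m.+1 ^+ p]>%G | p <- primes m.+1] ++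
          [seq typeB p | p <- primes m].
have uL : uniq L.
  rewrite cat_uniq; apply/and3P; split.
  - rewrite map_inj_in_uniq ?primes_uniq // => p q pm qm e.
    apply: (cycleX_prime_inj (x := cyc m.+1)); rewrite ?oc //.
    have {}e : unit_type <[cyc m.+1 ^+ p]> = unit_type <[cyc m.+1 ^+ q]> := e.
    apply/eqP; rewrite eqEsubset; apply/andP.
    by split; (apply: unit_type_subset; first exact: cycleX); rewrite e subxx.
  - apply/hasPn=> _ /mapP[p pm ->]; apply/mapP=> -[q qm /esym/eqP].
    rewrite typeBE //; apply/negP/unit_type_neq_top_type.
    exact: maxgroupp (maxA q qm).
  rewrite map_inj_in_uniq ?primes_uniq // => p q pm qm; rewrite !typeBE // => e.
  apply: (cycleX_prime_inj (x := zperm m)); rewrite ?oz //.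
  apply/eqP; rewrite eqEsubset; apply/andP.
  by split; (apply: top_type_subset; first exact: cycleX); rewrite e subxx.
rewrite -(size_map (fun p => typeA <[cyc m.+1 ^+ p]>%G)) -(size_map typeB) -size_cat -/L.
rewrite -(card_uniqP uL); apply: eq_card => M; rewrite inE mem_cat.
apply/idP/orP => [/main[[U /maximal_cycleP[p pc ->] ->]|[p pm ->]]|].
- by rewrite oc in pc; left; apply/mapP; exists p.
- by right; apply/mapP; exists p.
case=> /mapP[p pm ->]; apply/main.
- by left; exists <[cyc m.+1 ^+ p]>%G => //; apply: maxA.
- by right; exists p.
Qed.
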